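(* Let $\mathcal Z\subset\mathbb C$ be the set of all roots of unity. If a subset $\mathcal Z'\subset\mathcal Z$ has no limit point, then the ring homomorphism $$\mathrm{ev}_{\mathcal Z'}:\widehat{\mathbb Z[q]}\to\prod_{\zeta\in\mathcal Z'}\mathbb Z[\zeta],\qquad f(q)\mapsto(f(\zeta))_{\zeta\in\mathcal Z'},$$ is not injective.
   Context: $\widehat{\mathbb Z[q]}=\varprojlim_n\mathbb Z[q]/((q)_n)$ with $(q)_n=(1-q)(1-q^2)\cdots(1-q^n)$. For a root of unity $\zeta$ and $f(q)\in\widehat{\mathbb Z[q]}$, $f(\zeta)\in\mathbb Z[\zeta]$ is the image of $f$ under the ring homomorphism $\widehat{\mathbb Z[q]}\to\mathbb Z[\zeta]$ induced by $q\mapsto\zeta$ (well defined since $(q)_n$ vanishes at $\zeta$ for $n\ge\mathrm{ord}(\zeta)$). Two roots of unity $\zeta,\xi$ are adjacent if $\zeta\xi^{-1}$ has prime power order. An element $\xi\in\mathcal Z$ is a limit point of $\mathcal Z'\subset\mathcal Z$ if there are infinitely many $\zeta\in\mathcal Z'$ adjacent to $\xi$. *)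

(* Defs.v *)
From HB Require Import structures.
From mathcomp Require Import all_boot all_algebra.
From mathcomp Require Import boolp classical_sets cardinality.
From mathcomp Require Export reals complex.

Set Implicit Arguments.
Unset Strict Implicit.
Unset Printing Implicit Defensive.

Import GRing.Theory.
Local Open Scope ring_scope.
Local Open Scope quotient_scope.

(* The product of a family of commutative rings, with pointwise operations.  It
   is only a [comPzRingType] because the index type may be empty. *)
Definition prod_ring (I : Type) (T : I -> comPzRingType) : Type :=
  forall i, T i.

Section ProdRing.
Variables (I : Type) (T : I -> comPzRingType).
Local Notation P := (prod_ring T).
Implicit Types f g h : P.

HB.instance Definition _ := gen_eqMixin P.
HB.instance Definition _ := gen_choiceMixin P.

Definition prod0 : P := fun=> 0.
Definition prod1 : P := fun=> 1.
Definition prod_opp f : P := fun i => - f i.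
Definition prod_add f g : P := fun i => f i + g i.
Definition prod_mul f g : P := fun i => f i * g i.

Fact prod_addA : associative prod_add.
Proof. by move=> f g h; apply: functional_extensionality_dep => i; exact: addrA. Qed.
Fact prod_addC : commutative prod_add.
Proof. by move=> f g; apply: functional_extensionality_dep => i; exact: addrC. Qed.
Fact prod_add0 : left_id prod0 prod_add.
Proof. by move=> f; apply: functional_extensionality_dep => i; exact: add0r. Qed.
Fact prod_addN : left_inverse prod0 prod_opp prod_add.
Proof. by move=> f; apply: functional_extensionality_dep => i; exact: addNr. Qed.

HB.instance Definition _ :=
  GRing.isZmodule.Build P prod_addA prod_addC prod_add0 prod_addN.

Fact prod_mulA : associative prod_mul.
Proof. by move=> f g h; apply: functional_extensionality_dep => i; exact: mulrA. Qed.
Fact prod_mulC : commutative prod_mul.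
Proof. by move=> f g; apply: functional_extensionality_dep => i; exact: mulrC. Qed.
Fact prod_mul1 : left_id prod1 prod_mul.
Proof. by move=> f; apply: functional_extensionality_dep => i; exact: mul1r. Qed.
Fact prod_mulD : left_distributive prod_mul prod_add.
Proof. by move=> f g h; apply: functional_extensionality_dep => i; exact: mulrDl. Qed.

HB.instance Definition _ :=
  GRing.Zmodule_isComPzRing.Build P prod_mulA prod_mulC prod_mul1 prod_mulD.

Lemma prod_1E i : (1 : P) i = 1. Proof. by []. Qed.
Lemma prod_subE f g i : (f - g) i = f i - g i. Proof. by []. Qed.
Lemma prod_mulE f g i : (f * g) i = f i * g i. Proof. by []. Qed.

End ProdRing.

Definition qpoch (n : nat) : {poly int} := \prod_(1 <= i < n.+1) (1 - 'X^i).

Lemma qpochS n : qpoch n.+1 = qpoch n * (1 - 'X^(n.+1)).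
Proof. by rewrite /qpoch big_nat_recr. Qed.

(* Ideals in MathComp are proper and (q)_0 = 1, so levels are shifted by one:
   level [n] is the quotient by ((q)_{n+1}).  The term n = 0 that is left out is
   the zero ring, which does not affect the limit. *)
Definition qideal (n : nat) : {pred {poly int}} :=
  fun p => `[< exists r, p = r * qpoch n.+1 >].

Fact qideal_closed n : idealr_closed (qideal n).
Proof.
split.
- by apply/asboolP; exists 0; rewrite mul0r.
- apply/asboolP => -[r /(congr1 (fun p : {poly int} => p.[1]))].
  rewrite hornerM /qpoch big_ltn // hornerM hornerD hornerN hornerXn expr1.
  by rewrite hornerC subrr mul0r mulr0 => /eqP; rewrite oner_eq0.
- move=> a u v /asboolP[r ->] /asboolP[s ->]; apply/asboolP.
  by exists (a * r + s); rewrite mulrDl mulrA.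
Qed.

HB.instance Definition _ n := isIdealr.Build {poly int} (qideal n)
  (qideal_closed n).

Definition Zq_mod (n : nat) : comNzRingType := {ideal_quot (qideal n)}.

Definition Zq_pi n (p : {poly int}) : Zq_mod n := \pi_{ideal_quot (qideal n)} p.
Definition Zq_repr n (x : Zq_mod n) : {poly int} :=
  repr (x : {ideal_quot (qideal n)}).

Lemma Zq_reprK n : cancel (@Zq_repr n) (@Zq_pi n).
Proof. by move=> x; exact: reprK. Qed.

Lemma Zq_piP n p p' :
  Zq_pi n p = Zq_pi n p' <-> exists r, p - p' = r * qpoch n.+1.
Proof.
split=> [/eqP|H]; last apply/eqP.
  by rewrite /Zq_pi -Quotient.idealrBE => /asboolP.
by rewrite /Zq_pi -Quotient.idealrBE; apply/asboolP.
Qed.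

Fact Zq_pi_zmod n : zmod_morphism (@Zq_pi n).
Proof. by move=> p r; rewrite /Zq_pi [LHS]raddfB. Qed.
Fact Zq_pi_monoid n : monoid_morphism (@Zq_pi n).
Proof. by split=> [|p r]; rewrite /Zq_pi ?[LHS]rmorph1 ?[LHS]rmorphM. Qed.

HB.instance Definition _ n :=
  GRing.isZmodMorphism.Build {poly int} (Zq_mod n) (@Zq_pi n) (@Zq_pi_zmod n).
HB.instance Definition _ n :=
  GRing.isMonoidMorphism.Build {poly int} (Zq_mod n) (@Zq_pi n)
    (@Zq_pi_monoid n).

Definition Zq_trans n (x : Zq_mod n.+1) : Zq_mod n := Zq_pi n (Zq_repr x).

Lemma Zq_trans_pi n p : Zq_trans (Zq_pi n.+1 p) = Zq_pi n p.
Proof.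
apply/Zq_piP; have /Zq_piP[r rE] := Zq_reprK (Zq_pi n.+1 p).
by exists (r * (1 - 'X^(n.+2))); rewrite rE [in LHS]qpochS mulrAC mulrA.
Qed.

Fact Zq_trans_zmod n : zmod_morphism (@Zq_trans n).
Proof.
move=> x y; rewrite -[x]Zq_reprK -[y]Zq_reprK -rmorphB.
by rewrite !Zq_trans_pi rmorphB.
Qed.
Fact Zq_trans_monoid n : monoid_morphism (@Zq_trans n).
Proof.
split=> [|x y]; first by rewrite -(rmorph1 (@Zq_pi n.+1)) Zq_trans_pi rmorph1.
rewrite -[x]Zq_reprK -[y]Zq_reprK -rmorphM.
by rewrite !Zq_trans_pi rmorphM.
Qed.

HB.instance Definition _ n :=
  GRing.isZmodMorphism.Build (Zq_mod n.+1) (Zq_mod n) (@Zq_trans n)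
    (@Zq_trans_zmod n).
HB.instance Definition _ n :=
  GRing.isMonoidMorphism.Build (Zq_mod n.+1) (Zq_mod n) (@Zq_trans n)
    (@Zq_trans_monoid n).

Definition Zq_compatible : {pred prod_ring Zq_mod} :=
  fun f => `[< forall n, Zq_trans (f n.+1) = f n >].

Fact Zq_compatible_closed : subring_closed Zq_compatible.
Proof.
split=> [|f g|f g].
- by apply/asboolP => n; rewrite !prod_1E rmorph1.
- move=> /asboolP fc /asboolP gc; apply/asboolP => n.
  by rewrite !prod_subE rmorphB /= fc gc.
- move=> /asboolP fc /asboolP gc; apply/asboolP => n.
  by rewrite !prod_mulE rmorphM /= fc gc.
Qed.

HB.instance Definition _ := GRing.isSubringClosed.Build (prod_ring Zq_mod)
  Zq_compatible Zq_compatible_closed.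

(* The inverse limit of the rings Z[q]/((q)_n). *)
Record habiro := Habiro {
  habiro_val : prod_ring Zq_mod;
  _ : habiro_val \in Zq_compatible }.

HB.instance Definition _ := [isSub for habiro_val].
HB.instance Definition _ := [Choice of habiro by <:].
HB.instance Definition _ :=
  GRing.SubChoice_isSubComPzRing.Build (prod_ring Zq_mod) Zq_compatible habiro
    Zq_compatible_closed.

Definition habiro_level (f : habiro) (n : nat) : Zq_mod n := habiro_val f n.
Coercion habiro_level : habiro >-> Funclass.

Lemma habiro_trans (f : habiro) n : Zq_trans (f n.+1) = f n.
Proof. by have /asboolP := valP f; apply. Qed.
Lemma habiro_1E n : (1 : habiro) n = 1. Proof. by []. Qed.
Lemma habiro_subE (f g : habiro) n : (f - g) n = f n - g n. Proof. by []. Qed.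
Lemma habiro_mulE (f g : habiro) n : (f * g) n = f n * g n. Proof. by []. Qed.

Section Evaluation.
Variable C : fieldType.

Definition is_unity_root : {pred C} :=
  fun z => `[< exists2 n, (0 < n)%N & z ^+ n = 1 >].

Record unity_root := UnityRoot {
  unity_root_val :> C;
  _ : unity_root_val \in is_unity_root }.

HB.instance Definition _ := [isSub for unity_root_val].
HB.instance Definition _ := [Choice of unity_root by <:].

Implicit Types (z x : unity_root).

Fact unity_order_exists z : exists n, n.-primitive_root (z : C).
Proof.
case: z => z /= /asboolP[n n0 zn].
by have [m] := prim_order_exists n0 zn; exists m.
Qed.

Definition unity_order z : nat := xchoose (unity_order_exists z).

Lemma unity_orderP z : (unity_order z).-primitive_root (z : C).
Proof. exact: (xchooseP (unity_order_exists z)). Qed.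

(* The order p ^ 0 = 1 is allowed, so a root is adjacent to itself; this has no
   bearing on limit points. *)
Definition adjacent z x : Prop :=
  exists p e : nat, prime p /\ (p ^ e).-primitive_root ((z : C) / (x : C)).

Definition limit_point (Z' : set unity_root) x : Prop :=
  infinite_set [set z | Z' z /\ adjacent z x]%classic.

Definition int_poly_eval (c : C) (p : {poly int}) : C := (map_poly intr p).[c].

Fact int_poly_eval_zmod c : zmod_morphism (int_poly_eval c).
Proof. by move=> p r; rewrite /int_poly_eval rmorphB hornerD hornerN. Qed.
Fact int_poly_eval_monoid c : monoid_morphism (int_poly_eval c).
Proof.
by split=> [|p r]; rewrite /int_poly_eval ?rmorph1 ?rmorphM ?hornerC ?hornerM.
Qed.

HB.instance Definition _ c := GRing.isZmodMorphism.Build {poly int} C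
  (int_poly_eval c) (int_poly_eval_zmod c).
HB.instance Definition _ c := GRing.isMonoidMorphism.Build {poly int} C
  (int_poly_eval c) (int_poly_eval_monoid c).

Definition in_Zadj (c : C) : {pred C} :=
  fun a => `[< exists p, a = int_poly_eval c p >].

Fact in_Zadj_closed c : subring_closed (in_Zadj c).
Proof.
split=> [|a b|a b].
- by apply/asboolP; exists 1; rewrite rmorph1.
- by move=> /asboolP[p ->] /asboolP[r ->]; apply/asboolP; exists (p - r);
     rewrite rmorphB.
- by move=> /asboolP[p ->] /asboolP[r ->]; apply/asboolP; exists (p * r);
     rewrite rmorphM.
Qed.

HB.instance Definition _ c :=
  GRing.isSubringClosed.Build C (in_Zadj c) (in_Zadj_closed c).

(* The subring Z[c] of C. *)
Record Zadj (c : C) := ZAdj { Zadj_val :> C; _ : Zadj_val \in in_Zadj c }.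

HB.instance Definition _ c := [isSub for @Zadj_val c].
HB.instance Definition _ c := [Choice of Zadj c by <:].
HB.instance Definition _ c := [SubChoice_isSubComNzRing of Zadj c by <:].

Fact Zadj_eval_subproof (c : C) p : int_poly_eval c p \in in_Zadj c.
Proof. by apply/asboolP; exists p. Qed.

Definition Zadj_eval (c : C) (p : {poly int}) : Zadj c :=
  ZAdj (Zadj_eval_subproof c p).

Fact Zadj_eval_zmod c : zmod_morphism (Zadj_eval c).
Proof. by move=> p r; apply: val_inj; rewrite /= rmorphB. Qed.
Fact Zadj_eval_monoid c : monoid_morphism (Zadj_eval c).
Proof. by split=> [|p r]; apply: val_inj; rewrite /= ?rmorph1 ?rmorphM. Qed.

HB.instance Definition _ c := GRing.isZmodMorphism.Build {poly int} (Zadj c)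
  (Zadj_eval c) (Zadj_eval_zmod c).
HB.instance Definition _ c := GRing.isMonoidMorphism.Build {poly int} (Zadj c)
  (Zadj_eval c) (Zadj_eval_monoid c).

(* f(z), computed from a representative of f modulo (q)_{ord(z)+1};
   [habiro_evalE] shows that every level n >= ord(z) gives the same value. *)
Definition habiro_eval z (f : habiro) : Zadj z :=
  Zadj_eval z (Zq_repr (f (unity_order z))).

Lemma Zadj_eval_qpoch z n : (unity_order z <= n)%N -> Zadj_eval z (qpoch n) = 0.
Proof.
have zP := unity_orderP z; have z0 := prim_order_gt0 zP => le_zn.
apply: val_inj => /=; rewrite /qpoch.
rewrite (bigD1_seq (unity_order z)) ?mem_index_iota ?iota_uniq ?z0 //=.
rewrite rmorphM rmorphB rmorph1 /=.
by rewrite {1}/int_poly_eval map_polyXn hornerXn prim_expr_order // subrr mul0r.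
Qed.

Lemma Zadj_eval_Zq_pi z n p r : (unity_order z <= n.+1)%N ->
  Zq_pi n p = Zq_pi n r -> Zadj_eval z p = Zadj_eval z r.
Proof.
move=> le_zn /Zq_piP[s ps]; apply/eqP; rewrite -subr_eq0 -rmorphB ps rmorphM.
by rewrite /= Zadj_eval_qpoch // mulr0.
Qed.

Lemma habiro_evalE z (f : habiro) n p : (unity_order z <= n.+1)%N ->
  f n = Zq_pi n p -> habiro_eval z f = Zadj_eval z p.
Proof.
have stepP m : (unity_order z <= m.+1)%N ->
  Zadj_eval z (Zq_repr (f m.+1)) = Zadj_eval z (Zq_repr (f m)).
  move=> le_zm; apply: (Zadj_eval_Zq_pi le_zm).
  by rewrite Zq_reprK -[in RHS]habiro_trans.
have lvl m : Zadj_eval z (Zq_repr (f (unity_order z + m)%N)) = habiro_eval z f.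
  elim: m => [|m IHm]; first by rewrite addn0.
  by rewrite addnS stepP // -addSn ltnW // ltnS leq_addr.
move=> le_zn fn; transitivity (Zadj_eval z (Zq_repr (f n))); last first.
  by apply: (Zadj_eval_Zq_pi le_zn); rewrite Zq_reprK.
move: le_zn; rewrite leq_eqVlt ltnS => /orP[/eqP zn|/subnKC <-].
  by rewrite /habiro_eval zn stepP // zn.
by rewrite lvl.
Qed.

Definition ev (Z' : set unity_root) (f : habiro) :
    prod_ring (fun w : Z' => Zadj (val w)) :=
  fun w => habiro_eval (val w) f.

Arguments ev : clear implicits.

Fact ev_zmod Z' : zmod_morphism (ev Z').
Proof.
move=> f g; apply: functional_extensionality_dep => -[z zP] /=.
rewrite [RHS]/(_ - _) /ev /=.
transitivity (Zadj_eval z (Zq_repr (f (unity_order z))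
  - Zq_repr (g (unity_order z)))); last exact: rmorphB.
by apply: (@habiro_evalE z _ (unity_order z)); rewrite ?leqnSn // habiro_subE rmorphB /= !Zq_reprK.
Qed.

Fact ev_monoid Z' : monoid_morphism (ev Z').
Proof.
split=> [|f g]; apply: functional_extensionality_dep => -[z zP] /=; rewrite /ev /=.
  rewrite -[RHS](rmorph1 (Zadj_eval z)).
  by apply: (@habiro_evalE z _ (unity_order z)); rewrite ?leqnSn // habiro_1E rmorph1.
transitivity (Zadj_eval z (Zq_repr (f (unity_order z))
  * Zq_repr (g (unity_order z)))); last exact: rmorphM.
by apply: (@habiro_evalE z _ (unity_order z)); rewrite ?leqnSn // habiro_mulE rmorphM /= !Zq_reprK.
Qed.

HB.instance Definition _ (Z' : set unity_root) :=
  GRing.isZmodMorphism.Build habiro (prod_ring (fun w : Z' => Zadj (val w))) (ev Z') (@ev_zmod Z').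
HB.instance Definition _ (Z' : set unity_root) :=
  GRing.isMonoidMorphism.Build habiro (prod_ring (fun w : Z' => Zadj (val w))) (ev Z') (@ev_monoid Z').

End Evaluation.

Arguments ev {C} Z' f.

(* Main.v *)
(* Let N be the set of orders of the elements of Z'.  If m/n is not an integral
   power of a prime, the cyclotomic polynomials Phi_m and Phi_n generate the unit
   ideal of Z[q].  Since Z' has no limit point, it follows that for each k the
   polynomial Phi_m is a unit modulo (q)_k for all but finitely many m in N.
   Multiplying Phi_m by an inverse modulo (q)_k, with k growing with m, gives
   factors tending to 1, whose infinite product f converges in the Habiro ring
   and vanishes on Z'.  Fix some n outside N; leaving the Phi_m that are not
   invertible modulo (q)_n uncorrected makes f nonzero at the primitive n-th
   roots of unity. *)
Require Import Defs.
From mathcomp Require Import all_boot all_algebra all_field.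
From mathcomp Require Import boolp classical_sets cardinality reals complex.
From mathcomp Require Import ring zify.

Set Implicit Arguments.
Unset Strict Implicit.
Unset Printing Implicit Defensive.

Import GRing.Theory Num.Theory.
Local Open Scope classical_set_scope.
Local Open Scope ring_scope.

(** * Comaximal elements of a commutative ring *)

Definition comaximal (A : comPzRingType) (a b : A) : Prop :=
  exists u v, u * a + v * b = 1.

Section Comaximal.
Variable A : comPzRingType.
Implicit Types a b c : A.

Lemma comaximal_sym a b : comaximal a b -> comaximal b a.
Proof. by case=> u [v uv]; exists v, u; rewrite addrC. Qed.

Lemma comaximalMr a b c : comaximal a b -> comaximal a c -> comaximal a (b * c).
Proof.
case=> u [v uv] [s [t st]].
exists (u * s * a + u * t * c + v * b * s), (v * t).
transitivity ((u * a + v * b) * (s * a + t * c)); first by ring.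
by rewrite uv st mulr1.
Qed.

Lemma comaximal_prodr I (r : seq I) (P : pred I) (F : I -> A) a :
  (forall i, P i -> comaximal a (F i)) -> comaximal a (\prod_(i <- r | P i) F i).
Proof.
move=> aF; apply: (big_ind (comaximal a)) => //; last exact: comaximalMr.
by exists 0, 1; rewrite mul0r add0r mulr1.
Qed.

Lemma comaximal_prodl I (r : seq I) (P : pred I) (F : I -> A) a :
  (forall i, P i -> comaximal (F i) a) -> comaximal (\prod_(i <- r | P i) F i) a.
Proof.
by move=> Fa; apply/comaximal_sym/comaximal_prodr => i /Fa/comaximal_sym.
Qed.

Lemma comaximal_of_multiple a b c d : comaximal (c * a) (d * b) -> comaximal a b.
Proof. by case=> u [v uv]; exists (u * c), (v * d); rewrite -!mulrA. Qed.

(* Write [a s = b t + 1]: then [1 = [a s]_x - x [b t]_x]. *)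
Lemma comaximal_geom (x : A) (a b : nat) : (0 < a)%N -> coprime a b ->
  comaximal (\sum_(i < a) x ^+ i) (\sum_(i < b) x ^+ i).
Proof.
have geomM (c d : nat) : \sum_(i < c * d) x ^+ i
    = (\sum_(j < d) x ^+ (c * j)%N) * \sum_(i < c) x ^+ i.
  elim: d => [|d IHd]; first by rewrite muln0 !big_ord0 mul0r.
  rewrite mulnSr big_split_ord /= IHd big_ord_recr /= mulrDl; congr (_ + _).
  by rewrite mulr_sumr; apply: eq_bigr => i _; rewrite exprD.
move=> a0 cab; have [s t st _] := egcdnP b a0.
exists (\sum_(j < s) x ^+ (a * j)%N), (- x * \sum_(j < t) x ^+ (b * j)%N).
rewrite -geomM -mulrA -geomM mulnC st (eqP cab) addn1 big_ord_recl expr0.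
rewrite mulNr mulr_sumr mulnC.
by under [X in _ - X]eq_bigr do rewrite -exprS; rewrite addrK.
Qed.

End Comaximal.

(** * Comaximality of cyclotomic polynomials *)

(** The sum is $(q^{ec}-1)/(q^e-1)$, the product of ['Phi_d] over the divisors $d$ of [e * c] that
    do not divide [e]; as [c] exceeds 1, [e * c] is one of them. *)
Lemma Cyclotomic_geom e c : (0 < e)%N -> (1 < c)%N ->
  exists r, \sum_(i < c) ('X^e) ^+ i = r * 'Phi_(e * c).
Proof.
move=> e0 c1; have ec0 : (0 < e * c)%N by rewrite muln_gt0 e0 ltnW.
have dvd_ec : (e * c \in divisors (e * c))%N by rewrite -dvdn_divisors.
have nec : ~~ (e * c %| e)%N.
  by rewrite -[X in (_ %| X)%N]muln1 dvdn_pmul2l // dvdn1 gtn_eqF.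
have Xe : 'X^e - 1 != 0 :> {poly int} by rewrite monic_neq0 ?monicXnsubC.
exists (\prod_(d <- rem (e * c)%N (divisors (e * c)) | ~~ (d %| e)%N) 'Phi_d).
apply: (mulfI Xe); rewrite -subrX1 -exprM -(prod_Cyclotomic ec0).
rewrite (bigID (fun d => d %| e)%N) /=; congr (_ * _); last first.
  by rewrite (big_rem _ dvd_ec) /= nec mulrC.
rewrite -(prod_Cyclotomic e0) -big_filter; apply: perm_big; apply: uniq_perm.
- exact/filter_uniq/divisors_uniq.
- exact: divisors_uniq.
move=> d; rewrite mem_filter -!dvdn_divisors //.
by case: (boolP (d %| e)%N) => //= de; rewrite dvdn_mulr.
Qed.

Lemma Cyclotomic_dvd n : (0 < n)%N -> exists r, 'X^n - 1 = r * 'Phi_n :> {poly int}.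
Proof.
move=> n0; rewrite -prod_Cyclotomic // (big_rem n) -?dvdn_divisors //= mulrC.
by eexists.
Qed.

(* Modulo Phi_n, [q^(n c / p) = 1], so the multiple [[p]_(q^(n c / p))] of
   Phi_(n c) reduces to p. *)
Lemma Cyclotomic_mod_prime n c p : (0 < n)%N -> (0 < c)%N -> prime p -> (p %| c)%N ->
  exists u v, u * 'Phi_(n * c) + v * 'Phi_n = p%:R.
Proof.
move=> n0 c0 p_pr /dvdnP[k ck]; have k0 : (0 < k)%N by move: c0; rewrite ck muln_gt0; case/andP.
have nk0 : (0 < n * k)%N by rewrite muln_gt0 n0.
have [r] := Cyclotomic_geom nk0 (prime_gt1 p_pr); rewrite -mulnA -ck => Er.
have [s Es] := Cyclotomic_dvd n0.
have geom1 (y : {poly int}) :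
    exists t, \sum_(i < p) y ^+ i = t * (y - 1) + p%:R.
  exists (\sum_(i < p) \sum_(j < i) y ^+ j); rewrite mulr_suml.
  under [X in _ = X + _]eq_bigr => i _ do rewrite mulrC -subrX1.
  by rewrite sumrB sumr_const card_ord subrK.
have [t Et] := geom1 'X^(n * k).
have: 'X^(n * k) - 1 = (\sum_(i < k) 'X^n ^+ i) * s * 'Phi_n :> {poly int}.
  by rewrite exprM subrX1 Es; ring.
move=> Enk; exists r, (- t * ((\sum_(i < k) 'X^n ^+ i) * s)).
by rewrite -Er Et Enk; ring.
Qed.

(** Since [c] has two distinct prime factors, the ideal of the two polynomials contains two coprime
    integers, by [Cyclotomic_mod_prime]. *)
Lemma comaximal_Cyclotomic_mul n c : (0 < n)%N -> (0 < c)%N ->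
  (forall p e, prime p -> c <> (p ^ e)%N) -> comaximal 'Phi_(n * c) 'Phi_n.
Proof.
move=> n0 c0 npp; have c1 : (1 < c)%N.
  (* Taking [e = 0] in the hypothesis rules out [c = 1]. *)
  by rewrite ltn_neqAle c0 andbT; apply/eqP => cE; apply: (npp 2%N 0%N _ (esym cE)).
set p := pdiv c; have p_pr : prime p by exact: pdiv_prime.
have [u [v uv]] := Cyclotomic_mod_prime n0 c0 p_pr (pdiv_dvd c).
(* A second prime comes from the prime-to-[p] part of [c], which is not 1 because [c] is no power of
   [p]. *)
have [q [q_pr qc qp]] : exists q, [/\ prime q, (q %| c)%N & q != p].
  have cE := partnC p c0; rewrite p_part in cE.
  have c'0 : (1 < c`_p^')%N.
    rewrite ltn_neqAle part_gt0 andbT; apply/eqP => c'1.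
    by rewrite -c'1 muln1 in cE; exact: npp p_pr (esym cE).
  exists (pdiv c`_p^'); have qp := pdiv_prime c'0; have qd := pdiv_dvd c`_p^'.
  split=> //; first exact: dvdn_trans qd (dvdn_part _ _).
  have := pnatP _ (ltnW c'0) (part_pnat p^' c) => /(_ _ qp qd).
  by rewrite !inE.
have [s [t st]] := Cyclotomic_mod_prime n0 c0 q_pr qc.
have cpq : coprime p q by rewrite prime_coprime // dvdn_prime2 // eq_sym.
have [a b ab _] := egcdnP q (prime_gt0 p_pr).
rewrite (eqP cpq) in ab.
exists (a%:R * u - b%:R * s), (a%:R * v - b%:R * t).
transitivity (a%:R * (u * 'Phi_(n * c) + v * 'Phi_n)
  - b%:R * (s * 'Phi_(n * c) + t * 'Phi_n) : {poly int}); first by ring.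
by rewrite uv st -!natrM ab natrD addrC addKr.
Qed.

(** If one index divides the other, the quotient is not a prime power and the previous lemma
    applies. Otherwise, with $d$ the gcd, ['Phi_m] and ['Phi_n] divide the geometric sums in $q^d$
    of lengths $m/d$ and $n/d$, which are comaximal because these lengths are coprime. *)
Lemma comaximal_Cyclotomic m n : (0 < m)%N -> (0 < n)%N ->
  (forall p e, prime p -> m <> (n * p ^ e)%N) ->
  (forall p e, prime p -> n <> (m * p ^ e)%N) ->
  comaximal 'Phi_m 'Phi_n.
Proof.
move=> m0 n0 mn nm.
have [/dvdnP[c]|nm'] := boolP (n %| m)%N.
  rewrite mulnC => mE; rewrite mE in m0 mn *; apply: comaximal_Cyclotomic_mul => //.
    by move: m0; rewrite muln_gt0 => /andP[].
  by move=> p e p_pr cE; apply: (mn p e p_pr); rewrite -cE.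
have [/dvdnP[c]|mn'] := boolP (m %| n)%N.
  rewrite mulnC => nE; rewrite nE in n0 nm *.
  apply/comaximal_sym/comaximal_Cyclotomic_mul => //.
    by move: n0; rewrite muln_gt0 => /andP[].
  by move=> p e p_pr cE; apply: (nm p e p_pr); rewrite -cE.
pose d := gcdn m n; have d0 : (0 < d)%N by rewrite gcdn_gt0 m0.
have mE : m = (d * (m %/ d))%N by rewrite mulnC divnK // dvdn_gcdl.
have nE : n = (d * (n %/ d))%N by rewrite mulnC divnK // dvdn_gcdr.
have gt1 a b : (0 < a)%N -> ~~ (a %| b)%N -> (1 < a %/ gcdn a b)%N.
  move=> a0 ab; rewrite ltn_neqAle divn_gt0 ?gcdn_gt0 ?a0 // dvdn_leq ?dvdn_gcdl // andbT.
  apply: contra ab => /eqP E.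
  by rewrite -(divnK (dvdn_gcdl a b)) -E mul1n dvdn_gcdr.
have md : (1 < m %/ d)%N by exact: gt1.
have nd : (1 < n %/ d)%N by rewrite /d gcdnC; exact: gt1.
have [r rE] := Cyclotomic_geom d0 md; have [s sE] := Cyclotomic_geom d0 nd.
rewrite -mE in rE; rewrite -nE in sE.
apply: (@comaximal_of_multiple _ _ _ r s); rewrite -rE -sE.
apply: comaximal_geom; first exact: ltnW.
by rewrite /coprime -(eqn_pmul2l d0) muln_gcdr -mE -nE muln1.
Qed.

(** Each factor $1-q^i$ of $(q)_N$ is, up to sign, the product of the ['Phi_d] with $d \mid i$. *)
Lemma comaximal_Cyclotomic_qpoch m N :
  (forall d, (0 < d <= N)%N -> comaximal 'Phi_m 'Phi_d) -> comaximal 'Phi_m (qpoch N).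
Proof.
move=> cop; rewrite /qpoch big_nat_cond; apply: comaximal_prodr => i /andP[/andP[i0 iN] _].
apply: (@comaximal_of_multiple _ _ _ 1 (-1)).
rewrite mul1r mulN1r opprB -prod_Cyclotomic // big_seq_cond; apply: comaximal_prodr => d.
rewrite andbT -dvdn_divisors // => di; apply: cop.
by rewrite (dvdn_gt0 i0 di) (leq_trans (dvdn_leq i0 di)).
Qed.

(** * Roots of cyclotomic polynomials and adjacency of roots of unity *)

(** As $z^n=1$, some ['Phi_d] with $d \mid n$ vanishes at [z]; then $z^d=1$ forces $n \mid d$. *)
Lemma root_Cyclotomic (F : fieldType) n (z : F) :
  n.-primitive_root z -> int_poly_eval z 'Phi_n = 0.
Proof.
move=> zP; have n0 := prim_order_gt0 zP.
have: int_poly_eval z (\prod_(d <- divisors n) 'Phi_d) = 0.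
  rewrite prod_Cyclotomic // rmorphB rmorph1 /=.
  by rewrite /int_poly_eval map_polyXn hornerXn prim_expr_order // subrr.
rewrite rmorph_prod => /eqP; rewrite prodf_seq_eq0 => /hasP[/= d].
rewrite -dvdn_divisors // => dn /eqP d0.
suff -> : n = d by [].
apply/eqP; rewrite eqn_dvd dn andbT (prim_order_dvd zP) -subr_eq0; apply/eqP.
have [r /(congr1 (int_poly_eval z))] := Cyclotomic_dvd (dvdn_gt0 n0 dn).
rewrite rmorphM /= d0 mulr0 rmorphB rmorph1 /= => <-.
by rewrite /int_poly_eval map_polyXn hornerXn.
Qed.

(** From $z^m=1$ follows $m=nc$. If $c>1$, then ['Phi_m] divides $\sum_{i<c} q^{ni}$, whose value at
    [z] is $c$, nonzero in characteristic 0. *)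
Lemma root_Cyclotomic_order (F : numFieldType) m n (z : F) : (0 < m)%N ->
  n.-primitive_root z -> int_poly_eval z 'Phi_m = 0 -> m = n.
Proof.
move=> m0 zP zm; have n0 := prim_order_gt0 zP.
have evX k : int_poly_eval z 'X^k = z ^+ k.
  by rewrite /int_poly_eval map_polyXn hornerXn.
have /dvdnP[c] : (n %| m)%N.
  rewrite (prim_order_dvd zP) -subr_eq0; apply/eqP.
  have [r /(congr1 (int_poly_eval z))] := Cyclotomic_dvd m0.
  by rewrite rmorphM /= zm mulr0 rmorphB rmorph1 /= evX.
rewrite mulnC => mE; case: (ltnP 1 c) => [c1|]; last first.
  by rewrite leq_eqVlt ltnS leqn0 => /orP[]/eqP cE; move: m0; rewrite mE cE ?muln1 ?muln0.
have [r /(congr1 (int_poly_eval z))] := Cyclotomic_geom n0 c1.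
rewrite -mE rmorphM /= zm mulr0 rmorph_sum /=.
under eq_bigr do rewrite rmorphXn /= evX (prim_expr_order zP) expr1n.
by rewrite sumr_const card_ord => /eqP; rewrite pnatr_eq0 gtn_eqF // ltnW.
Qed.

(* The root x is the prime-to-p part of z. *)
Lemma adjacent_root_of_order (F : fieldType) (z : unity_root F) d p e : prime p ->
  unity_order z = (d * p ^ e)%N ->
  exists2 x : unity_root F, (x : F) ^+ d = 1 & adjacent z x.
Proof.
move=> p_pr; have zP := unity_orderP z; have m0 := prim_order_gt0 zP.
set m := unity_order z in zP m0 * => mE.
have d0 : (0 < d)%N by move: m0; rewrite mE muln_gt0 => /andP[].
set f := logn p m; set m' := (m`_p^')%N.
have m'E : m = (m' * p ^ f)%N by rewrite mulnC -p_part partnC.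
have co : coprime m' (p ^ f) by rewrite -p_part coprime_sym coprime_partC.
have m'd : (m' %| d)%N.
  rewrite -(@Gauss_dvdl _ _ (p ^ e)).
    by rewrite -mE m'E dvdn_mulr.
  rewrite coprime_sym coprimeXl // (@pnat_coprime p) ?pnat_id //; exact: part_pnat.
(* As $s \equiv 1$ modulo [m'] and $s \equiv 0$ modulo $p^f$, the order of $z^s$ divides [m'] and
   that of $z/z^s$ divides $p^f$. *)
pose s := chinese m' (p ^ f) 1%N 0%N.
have pfs : (p ^ f %| s)%N by rewrite /dvdn /s chinese_modr // mod0n.
have xd : ((z : F) ^+ s) ^+ d = 1.
  apply/eqP; rewrite -exprM -(prim_order_dvd zP) m'E mulnC.
  exact: dvdn_mul.
have xP : (z : F) ^+ s \in @is_unity_root F by apply/asboolP; exists d.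
exists (UnityRoot xP) => //=.
have [||k kP] := @prim_order_exists F (p ^ f) ((z : F) / (z : F) ^+ s).
- by rewrite expn_gt0 prime_gt0.
- rewrite expr_div_n -exprM; apply/eqP.
  have z0 : (z : F) != 0.
    apply/eqP => z0; have := prim_expr_order zP.
    by rewrite z0 expr0n gtn_eqF //= => /eqP; rewrite eq_sym oner_eq0.
  rewrite -(inj_eq (mulIf (expf_neq0 (s * p ^ f) z0))) divfK ?expf_neq0 // mul1r.
  rewrite (eq_prim_root_expr zP) m'E -{1}[(p ^ f)%N]mul1n -!muln_modl.
  by rewrite /s chinese_modl // mul1n.
by move=> /(dvdn_pfactor _ _ p_pr)[j _ kE]; exists p, j; rewrite -kE.
Qed.

Lemma finite_unity_roots (F : closedFieldType) d : (0 < d)%N ->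
  finite_set [set x : unity_root F | val x ^+ d = 1].
Proof.
move=> d0; have [r rE] := closed_field_poly_normal ('X^d - 1 : {poly F}).
have := @finite_preimage _ _ [set` r] (@unity_root_val F).
move/(_ (fun x y _ _ => @val_inj _ _ _ x y))/(_ (finite_seq r)).
apply: sub_finite_set => x /= xd; rewrite -root_prod_XsubC.
have : root ('X^d - 1 : {poly F}) (val x) by rewrite rootE !hornerE xd subrr.
by rewrite rE rootZ // (monicP (monicXnsubC 1 d0)) oner_neq0.
Qed.

(** Each such [z] is adjacent to one of the finitely many $x$ with $x^d=1$, and each of these has
    finitely many neighbours in [Z']; so only finitely many orders occur. *)
Lemma bounded_adjacent_orders (F : closedFieldType) (Z' : set (unity_root F)) d :
  (forall x, ~ limit_point Z' x) -> (0 < d)%N ->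
  exists M, forall z p e, Z' z -> prime p -> unity_order z = (d * p ^ e)%N ->
    (unity_order z < M)%N.
Proof.
move=> nlim d0.
have /finite_seqP[s sE] : finite_set ((@unity_order F) @`
    \bigcup_(x in [set x : unity_root F | val x ^+ d = 1])
      [set z | Z' z /\ adjacent z x]).
  apply/finite_image/bigcup_finite; first exact: finite_unity_roots.
  by move=> x _; apply: contrapT; exact: nlim.
exists (\max_(m <- s) m).+1 => z p e Zz p_pr zE.
have zs : unity_order z \in s.
  suff : [set` s] (unity_order z) by [].
  rewrite -sE; have [x xd zx] := adjacent_root_of_order p_pr zE.
  by exists z => //; exists x.
by rewrite ltnS (big_rem _ zs) leq_maxl.
Qed.

(** * Convergent products of cyclotomic polynomials in the Habiro ring *)

Lemma dvd_qpoch n k : exists r, qpoch (n + k) = r * qpoch n.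
Proof.
elim: k => [|k [r rE]]; first by exists 1; rewrite addn0 mul1r.
by exists (r * (1 - 'X^((n + k).+1))); rewrite addnS qpochS rE; ring.
Qed.

Lemma root_qpoch (F : fieldType) n N (z : F) : n.-primitive_root z -> (n <= N)%N ->
  int_poly_eval z (qpoch N) = 0.
Proof.
move=> zP nN; case: n zP nN => [/prim_order_gt0//|n] zP nN; rewrite -(subnKC nN).
have [r ->] := dvd_qpoch n.+1 (N - n.+1); rewrite rmorphM /=.
rewrite qpochS rmorphM rmorphB rmorph1 /=.
rewrite {3}/int_poly_eval map_polyXn hornerXn (prim_expr_order zP).
by rewrite subrr !mulr0.
Qed.

Lemma habiro_Cyclotomic_product (N : set nat) n : (0 < n)%N -> ~ N n ->
  (forall m, N m -> (0 < m)%N) ->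
  (forall k, exists M, forall m, N m -> (M <= m)%N -> comaximal 'Phi_m (qpoch k)) ->
  exists2 f : habiro, f <> 0 &
    forall m, N m -> exists K, forall k, (K <= k)%N ->
      exists r, f k = Zq_pi k (r * 'Phi_m).
Proof.
move=> n0 Nn Ngt0 Ncop.
(* The bound [k <= M] lets the blocks from [M k] to [M k.+1] reach every large [m]. The modulus
   $(q)_{n+k+1}$ is a multiple of $(q)_{k+1}$, which gives compatibility, and vanishes at the
   primitive [n]-th roots of unity, which keeps [f] nonzero. *)
have /choice[M MP] k : exists M, (k <= M)%N /\
    forall m, N m -> (M <= m)%N -> comaximal 'Phi_m (qpoch (n + k.+1)).
  have [M MP] := Ncop (n + k.+1)%N; exists (k + M)%N; split; first exact: leq_addr.
  by move=> m Nm Mm; apply: MP => //; apply: leq_trans Mm; exact: leq_addl.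
have /choice[w wP] k : exists w : {poly int},
    (exists s, w - 1 = s * qpoch (n + k.+1)) /\
    forall m, N m -> (M k <= m < M k.+1)%N -> exists r, w = r * 'Phi_m.
  have : comaximal (\prod_(M k <= m < M k.+1 | `[< N m >]) 'Phi_m) (qpoch (n + k.+1)).
    rewrite big_nat_cond; apply: comaximal_prodl => m /andP[/andP[Mm _] /asboolP Nm].
    exact: (MP k).2.
  (* The Bezout coefficient [a] inverts the block product modulo $(q)_{n+k+1}$. *)
  case=> a [b ab]; exists (a * \prod_(M k <= m < M k.+1 | `[< N m >]) 'Phi_m); split.
    by exists (- b); rewrite (canRL (addrK _) ab) addrAC subrr add0r mulNr.
  move=> m /asboolP Nm mM; eexists.
  rewrite (big_rem m) ?mem_index_iota //= Nm mulrA mulrAC; reflexivity.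
pose u k := \prod_(0 <= m < M 0%N | `[< N m >]) 'Phi_m * \prod_(j < k) w j.
have uS k : u k.+1 = u k * w k by rewrite /u big_ord_recr /= mulrA.
have fP : (fun k => Zq_pi k (u k) : Zq_mod k) \in Zq_compatible.
  apply/asboolP => k; rewrite Zq_trans_pi; apply/Zq_piP.
  have [[s sE] _] := wP k; have [t tE] := dvd_qpoch k.+1 n.
  exists (u k * s * t); rewrite uS -[X in _ - X]mulr1 -mulrBr sE.
  by rewrite addnC tE; ring.
exists (Habiro fP).
  (* At [z] every [w j] takes the value 1, so [u n] takes the value of the finite uncorrected
     product, nonzero because its indices lie in [N] and differ from [n]. *)
  have [z zP] := C_prim_root_exists n0.
  move=> /(congr1 (fun f : habiro => f n)) f0.
  have [r] : exists r, u n - 0 = r * qpoch n.+1.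
    by apply/Zq_piP; rewrite rmorph0.
  rewrite subr0 => /(congr1 (int_poly_eval z)).
  rewrite [RHS]rmorphM /= (root_qpoch zP) // mulr0 rmorphM /= rmorph_prod => /eqP.
  rewrite mulf_eq0 prodf_seq_eq0 => /orP[/hasP[/= m _ /andP[/asboolP Nm /eqP m0]]|].
    by apply: Nn; rewrite -(root_Cyclotomic_order (Ngt0 m Nm) zP m0).
  rewrite rmorph_prod => /prodf_eq0[/= j _]; have [[s sE] _] := wP j.
  move/(congr1 (int_poly_eval z)): sE.
  rewrite rmorphM /= (root_qpoch zP) ?leq_addr // mulr0 rmorphB rmorph1 /=.
  by move/eqP; rewrite subr_eq0 => /eqP ->; rewrite oner_eq0.
move=> m Nm.
have dvdu k : (exists r, u k = r * 'Phi_m) -> forall l, (k <= l)%N ->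
    exists r, u l = r * 'Phi_m.
  move=> uk l /subnKC <-; elim: (l - k)%N => [|i [r rE]]; first by rewrite addn0.
  by rewrite addnS uS rE; exists (r * w (k + i)%N); ring.
suff [K uK] : exists K, exists r, u K = r * 'Phi_m.
  by exists K => k /(dvdu K uK)[r rE]; exists r; rewrite -rE.
have ex : exists k, (m < M k)%N by exists m.+1; exact: (MP m.+1).1.
(* [M] need not be monotone, but the least [k] with [m < M k] still locates [m]: in the uncorrected
   product if it is 0, in the block ending at [M k] otherwise. *)
case: (ex_minnP ex) => -[|k] mM minM; last first.
  exists k.+1; have [_ wk] := wP k.
  have [|r rE] := wk m Nm; last by exists (u k * r); rewrite uS rE mulrA.
  by rewrite mM andbT leqNgt; apply/negP => /minM; rewrite ltnn.
exists 0%N; rewrite /u big_ord0 mulr1 (big_rem m) ?mem_index_iota //=.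
by rewrite asboolT // mulrC; eexists.
Qed.

Theorem proposition12p2 (R : realType) (Z' : set (unity_root R[i])) :
  (forall x : unity_root R[i], ~ limit_point Z' x) ->
  ~ injective (ev Z' : {rmorphism habiro -> prod_ring (fun z : Z' => Zadj (val z))}).
Proof.
move=> nlim inj_ev; pose N := [set m | exists2 z, Z' z & unity_order z = m].
have Ngt0 m : N m -> (0 < m)%N.
  by case=> z _ <-; exact: prim_order_gt0 (unity_orderP z).
have Nbound d : (0 < d)%N -> exists M, forall m p e,
    N m -> (M <= m)%N -> prime p -> m <> (d * p ^ e)%N.
  move=> d0; have [M MP] := bounded_adjacent_orders nlim d0.
  exists M => m p e [z Zz <-] Mm p_pr /(MP z p e Zz p_pr).
  by rewrite ltnNge Mm.
have [n n0 Nn] : exists2 n, (0 < n)%N & ~ N n.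
  (* The prime powers in [N] are bounded by [M], and $2^M \ge M$. *)
  have [M MP] := Nbound 1%N isT; exists (2 ^ M)%N; first by rewrite expn_gt0.
  move=> /(MP _ 2%N M) []; rewrite ?mul1n //.
  exact/ltnW/ltn_expl.
have Ncop d : (0 < d)%N ->
    exists M, forall m, N m -> (M <= m)%N -> comaximal 'Phi_m 'Phi_d.
  (* The bound [M] excludes $m=dp^e$, and $m>d$ excludes $d=mp^e$. *)
  move=> d0; have [M MP] := Nbound d d0; exists (M + d.+1)%N => m Nm Mm.
  have m0 := Ngt0 m Nm; apply: comaximal_Cyclotomic => // p e p_pr.
    by apply: MP => //; apply: leq_trans Mm; exact: leq_addr.
  move=> dE; suff : (m <= d)%N by lia.
  by rewrite dE leq_pmulr // expn_gt0 prime_gt0.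
have Nqpoch k : exists M, forall m, N m -> (M <= m)%N -> comaximal 'Phi_m (qpoch k).
  have /choice[M MP] (d : nat) : exists M, (0 < d)%N ->
      forall m, N m -> (M <= m)%N -> comaximal 'Phi_m 'Phi_d.
    by case: (posnP d) => [->|/Ncop[M MP]]; [exists 0%N | exists M].
  exists (\max_(d < k.+1) M d) => m Nm Mm.
  apply: comaximal_Cyclotomic_qpoch => d /andP[d0 dk]; apply: MP => //.
  by apply: leq_trans Mm; rewrite -ltnS in dk; exact: (leq_bigmax (Ordinal dk)).
have [f f0 fN] := habiro_Cyclotomic_product n0 Nn Ngt0 Nqpoch.
apply/f0/inj_ev; rewrite rmorph0; apply: functional_extensionality_dep => -[z zZ'].
have [|K fK] := fN (unity_order z); first by exists z => //; exact: set_mem.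
(* This level is high enough both for divisibility by the cyclotomic polynomial of the order of [z]
   and for reading off the value at [z]. *)
have [r fr] := fK _ (leq_maxl K (unity_order z)).
rewrite /= /ev /= (habiro_evalE _ fr); last by rewrite leqW // leq_maxr.
by apply: val_inj; rewrite /= rmorphM /= root_Cyclotomic ?mulr0 //; exact: unity_orderP.
Qed.
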